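(* If $A\subset\mathbb{Z}$ is a finite Sidon set with at least two elements, then $|A+2\cdot A|>|A+A|$.
   Context: A finite set $A\subset\mathbb{Z}$ is a Sidon set if it contains no nontrivial additive quadruple, i.e. whenever $a,b,c,d\in A$ satisfy $a+b=c+d$, then $\{a,b\}=\{c,d\}$. For an integer $k$, $A+k\cdot A=\{a+kb:a,b\in A\}$; $A+A$ is the case $k=1$. *)

(* Defs.v *)
From mathcomp Require Import all_boot all_order all_algebra.
From mathcomp Require Import finmap.

Set Implicit Arguments.
Unset Strict Implicit.
Unset Printing Implicit Defensive.

Import GRing.Theory.
Local Open Scope fset_scope.
Local Open Scope ring_scope.

(* The equality [fset a; b] = [fset c; d] is between unordered pairs, so
   a = b is allowed: a + a = c + d then forces c = d = a. *)
Definition sidon (A : {fset int}) : Prop :=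
  forall a b c d : int,
    a \in A -> b \in A -> c \in A -> d \in A ->
    a + b = c + d -> [fset a; b] = [fset c; d].

Definition add_dilate (A : {fset int}) (k : int) : {fset int} :=
  [fset a + k * b | a in A, b in A].

(* Main.v *)
Require Import Defs.
From mathcomp Require Import all_boot all_order all_algebra.
From mathcomp Require Import finmap.
From mathcomp Require Import zify.

Set Implicit Arguments.
Unset Strict Implicit.
Unset Printing Implicit Defensive.

Local Open Scope fset_scope.

(** Both sizes are compared with the number of ordered pairs of elements of
    [A], using the increasing pairs (d, b), with d < b, as a yardstick.

    - As addition is commutative, [A + A] is already the set of sums of the
      pairs that are not increasing; so |A + A| <= |A|^2 - |increasing pairs|.
    - Among the pairs (c, d) sharing a value c + 2 d, keep the one with the
      largest d.  The kept pairs inject into [A + 2 . A], so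
      |A + 2 . A| >= |A|^2 - |discarded pairs|.
    - A discarded (c, d), called beaten below, has a competitor (a, b) with d < b and
      c - a = 2 (b - d).  The increasing pair (d, b) determines (c, d):
      in a Sidon set a nonzero difference, here 2 (b - d), has only one
      representation c - a.  So there are at most as many discarded pairs as
      increasing ones ([card_beaten_lt]).
    - There are strictly fewer, because the increasing pair with the largest
      gap b - d never arises this way: 2 (b - d) would be a larger gap. *)

Definition increasing_pairs (A : {fset int}) : {fset int * int} :=
  [fset p in A `*` A | (p.1 < p.2)%R].

(** The winner is the second argument, so that the competitors of [p] are
    found by searching with [beats p]. *)
Definition beats (p q : int * int) : bool :=
  (q.1 + 2%Z * q.2 == p.1 + 2%Z * p.2)%R && (p.2 < q.2)%R.

Definition beaten_pairs (A : {fset int}) : {fset int * int} :=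
  [fset p in A `*` A | has (beats p) (A `*` A)].

Lemma sidon_sub_inj (A : {fset int}) (a b c d : int) :
  sidon A -> a \in A -> b \in A -> c \in A -> d \in A ->
  (a - b = c - d)%R -> a != b -> a = c.
Proof.
move=> sA aA bA cA dA eq_sub neq_ab.
have /fsetP/(_ a) : [fset a; d] = [fset c; b] by apply: sA => //; lia.
by rewrite !inE eqxx (negPf neq_ab) orbF /= => /esym/eqP.
Qed.

Lemma fset_argmax (T : choiceType) (S : {fset T}) (f : T -> int) :
  S != fset0 ->
  exists2 x, x \in S & forall y, y \in S -> (f y <= f x)%R.
Proof.
case/fset0Pn=> x0 x0S.
case: (Order.TotalTheory.arg_maxP (fun x : S => f (val x)) (isT : xpredT [` x0S]))
  => x _ max_x.
by exists (val x) => [|y yS]; [exact: valP | exact: (max_x [` yS])].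
Qed.

Lemma increasing_pairs_neq0 (A : {fset int}) :
  (2 <= #|` A|)%N -> increasing_pairs A != fset0.
Proof.
move=> cardA.
have /fset0Pn[a aA] : A != fset0 by rewrite -cardfs_gt0; lia.
have /fset0Pn[b] : A `\ a != fset0.
  by rewrite -cardfs_gt0; have := cardfsD1 a A; rewrite aA; lia.
rewrite !inE => /andP[neq_ba bA].
have [lt_ab | le_ba] := boolP (a < b)%R.
  by apply/fset0Pn; exists (a, b); rewrite !inE /= aA bA.
apply/fset0Pn; exists (b, a); rewrite !inE /= aA bA /=; lia.
Qed.

Lemma card_add_dilate1_le (A : {fset int}) :
  (#|` add_dilate A 1%Z| + #|` increasing_pairs A| <= #|` A `*` A|)%N.
Proof.
have subP : increasing_pairs A `<=` A `*` A by exact: fset_sub.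
rewrite -(cardfsID (increasing_pairs A) (A `*` A)) addnC.
rewrite (fsetIidPr subP) leq_add2l.
pose sum (p : int * int) := (p.1 + p.2)%R.
have := leq_imfset_card imfset_key sum (mem (A `*` A `\` increasing_pairs A)).
apply: leq_trans.
apply/fsubset_leq_card/fsubsetP => _ /imfset2P[a aA [b bA ->]].
have [lt_ab | le_ba] := boolP (a < b)%R.
  apply/imfsetP; exists (b, a); last by rewrite /sum /=; lia.
  rewrite !inE /= aA bA /=; lia.
apply/imfsetP; exists (a, b); last by rewrite /sum /=; lia.
by rewrite !inE /= aA bA /= andbT.
Qed.

Lemma card_add_dilate2_ge (A : {fset int}) :
  (#|` A `*` A| <= #|` add_dilate A 2%Z| + #|` beaten_pairs A|)%N.
Proof.
have subN : beaten_pairs A `<=` A `*` A by exact: fset_sub.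
rewrite -(cardfsID (beaten_pairs A) (A `*` A)) addnC.
rewrite (fsetIidPr subN) leq_add2r.
pose val2 (p : int * int) := (p.1 + 2%Z * p.2)%R.
have inj_val2 : {in A `*` A `\` beaten_pairs A &, injective val2}.
  move=> p q /fsetDP[pA pN] /fsetDP[qA qN] eq_val.
  have not_beats r s : r \in A `*` A -> s \in A `*` A ->
      r \notin beaten_pairs A -> ~~ beats r s.
    move=> rA sA; apply: contra => beats_rs.
    by rewrite !inE /= -in_fsetM rA; apply/hasP; exists s.
  move: (not_beats p q pA qA pN) (not_beats q p qA pA qN) eq_val.
  rewrite /beats /val2; case: p {pA pN} => a b; case: q {qA qN} => c d /=.
  by move=> ? ? ?; congr pair; lia.
rewrite -(card_in_imfset imfset_key inj_val2).
apply/fsubset_leq_card/fsubsetP => _ /imfsetP[[a b] /= /fsetDP[abA _] ->].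
move: abA; rewrite in_fsetM => /andP[/= aA bA].
by apply/imfset2P; exists a => //; exists b.
Qed.

(** If [q] beats [p] then p.1 - q.1 is twice the gap q.2 - p.2, and it is not
    zero because the gap is positive; so p.1 is the larger end of the only
    representation of that number as a difference. *)
Lemma beats_inj (A : {fset int}) (p q p' q' : int * int) :
  sidon A -> p.1 \in A -> q.1 \in A -> p'.1 \in A -> q'.1 \in A ->
  beats p q -> beats p' q' -> p.2 = p'.2 -> q.2 = q'.2 -> p = p'.
Proof.
rewrite /beats; case: p q p' q' => [a b] [c d] [a' b'] [c' d'] /=.
move=> sA aA cA aA' cA' ? ? eq_b eq_d.
by congr pair => //; apply: (sidon_sub_inj sA aA cA aA' cA'); lia.
Qed.

(** The injection sends a beaten pair to its second coordinate and that of a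
    competitor; the increasing pair [m] of largest gap escapes its image. *)
Lemma card_beaten_lt (A : {fset int}) :
  sidon A -> (2 <= #|` A|)%N ->
  (#|` beaten_pairs A| < #|` increasing_pairs A|)%N.
Proof.
move=> sA cardA.
pose gap (p : int * int) := (p.2 - p.1)%R.
have [m mP max_m] := fset_argmax gap (increasing_pairs_neq0 cardA).
(* Any competitor will do; the default [p] is never reached on beaten pairs. *)
pose w p := nth p (A `*` A) (find (beats p) (A `*` A)).
have wP p : p \in beaten_pairs A ->
    [/\ p.1 \in A, p.2 \in A, (w p).1 \in A, (w p).2 \in A & beats p (w p)].
  rewrite !inE /= => /andP[/andP[p1 p2] has_p].
  have : w p \in A `*` A by rewrite mem_nth // -has_find.
  by rewrite in_fsetM => /andP[w1 w2]; split=> //; exact: nth_find.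
pose h p := (p.2, (w p).2).
have inj_h : {in beaten_pairs A &, injective h}.
  move=> p q /wP[p1 _ wp1 _ beats_p] /wP[q1 _ wq1 _ beats_q] [eq2 eqw].
  exact: (beats_inj sA p1 wp1 q1 wq1).
rewrite -(card_in_imfset imfset_key inj_h).
rewrite (cardfsD1 m (increasing_pairs A)) mP add1n ltnS.
apply/fsubset_leq_card/fsubsetP => _ /imfsetP[p /= /wP[p1 p2 w1 w2 +] ->].
case/andP=> /eqP eq_p lt_p.
have gapP : ((w p).1, p.1) \in increasing_pairs A.
  rewrite !inE /= w1 p1 /=; lia.
rewrite !inE /= p2 w2 lt_p !andbT; apply/eqP => def_m.
by have := max_m _ gapP; rewrite -def_m /gap /=; lia.
Qed.

Theorem lemma17 (A : {fset int}) (sidonA : sidon A) (cardA : (2 <= #|` A|)%N) :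
  (#|` add_dilate A 1%Z| < #|` add_dilate A 2%Z|)%N.
Proof.
have le1 := card_add_dilate1_le A.
have ge2 := card_add_dilate2_ge A.
have lt := card_beaten_lt sidonA cardA.
lia.
Qed.
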